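(* Suppose $k,\ell$ are integers with $1 \leq k \leq \ell$. If a graph $G$ is proportionally $(k, \ell + 1)$-choosable, then $G$ is proportionally $(k, \ell)$-choosable.
   Context: All graphs are nonempty, finite and simple. For $m\in\mathbb{N}=\{1,2,3,\ldots\}$, $[m]=\{1,\ldots,m\}$. For integers $1\le k\le \ell$, a $(k,\ell)$-assignment for a graph $G$ is a function $L$ assigning to each vertex $v$ of $G$ a set $L(v)\subseteq[\ell]$ with $|L(v)|=k$. Let $\mathcal{L}=\bigcup_{v\in V(G)}L(v)$ and, for $c\in\mathcal{L}$, let $\eta(c)=|\{v\in V(G): c\in L(v)\}|$. A proportional $L$-coloring of $G$ is a function $f$ on $V(G)$ with $f(v)\in L(v)$ for every $v$, with $f(u)\ne f(v)$ whenever $u,v$ are adjacent, and with $|f^{-1}(c)|\in\{\lfloor \eta(c)/k\rfloor,\lceil \eta(c)/k\rceil\}$ for every $c\in\mathcal{L}$. $G$ is proportionally $(k,\ell)$-choosable if a proportional $L$-coloring of $G$ exists for every $(k,\ell)$-assignment $L$ for $G$. *)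

(* Defs.v *)
From HB Require Import structures.
From mathcomp Require Import all_boot all_order all_algebra.

Set Implicit Arguments.
Unset Strict Implicit.
Unset Printing Implicit Defensive.

Import GRing.Theory Num.Theory.

(* A graph is given by a finite vertex type V together with its adjacency
   relation; that the relation is symmetric and irreflexive and that V is
   nonempty are hypotheses of the theorem.  The colour set [l] = {1, ..., l} is
   encoded as 'I_l, so that the ordinal i stands for the colour i + 1. *)

Definition assignment (V : finType) (k l : nat) (L : V -> {set 'I_l}) : Prop :=
  forall v, #|L v| = k.

Definition palette (V : finType) (l : nat) (L : V -> {set 'I_l}) : {set 'I_l} :=
  \bigcup_(v : V) L v.

Definition eta (V : finType) (l : nat) (L : V -> {set 'I_l}) (c : 'I_l) : nat :=
  #|[set v | c \in L v]|.

Definition proportional_coloring (V : finType) (adj : rel V) (k l : nat)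
    (L : V -> {set 'I_l}) (f : V -> 'I_l) : Prop :=
  [/\ forall v, f v \in L v,
      forall u v, adj u v -> f u <> f v
    & forall c, c \in palette L ->
        let q : rat := ((eta L c)%:R / k%:R)%R in
        let n : nat := #|f @^-1: [set c]| in
        (n%:Z = Num.floor q \/ n%:Z = Num.ceil q)%R ].

Definition proportionally_choosable (V : finType) (adj : rel V) (k l : nat)
    : Prop :=
  forall L : V -> {set 'I_l}, assignment k L ->
    exists f : V -> 'I_l, proportional_coloring adj k L f.

(* Main.v *)
Require Import Defs.
From mathcomp Require Import all_boot all_order all_algebra.

(** Proportional choosability does not depend on the names of the colours. Renaming the lists along
    an injection [w] keeps their sizes and the multiplicity of each colour, so a proportional
    coloring of the renamed lists pulls back along [w]. The theorem is the case where [w] includes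
    the first [l] colours into [l.+1] colours. *)

Lemma proportionally_choosable_inj (k l m : nat) (V : finType) (adj : rel V)
    (w : 'I_l -> 'I_m) :
  injective w ->
  proportionally_choosable adj k m -> proportionally_choosable adj k l.
Proof.
move=> w_inj choosable_m L card_L.
have card_wL : assignment k (fun v => w @: L v).
  by move=> v; rewrite card_imset.
have [g [g_mem g_proper g_prop]] := choosable_m _ card_wL.
(* Each [g v] lies in the image [w @: L v], so [g] factors through [w] by a choice of preimages
   inside the lists. *)
have [f f_mem gE] :
    exists2 f : V -> 'I_l, forall v, f v \in L v & forall v, g v = w (f v).
  have g_lift v : exists2 c, c \in L v & g v = w c by exact/imsetP.
  by have [f f_mem gE] := fin_all_exists2 g_lift; exists f.
exists f; split=> // [u v adj_uv f_uv|c c_pal].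
  by apply: (g_proper u v adj_uv); rewrite !gE f_uv.
have wc_pal : w c \in palette (fun v => w @: L v).
  have /bigcupP[v _ c_v] := c_pal.
  by apply/bigcupP; exists v => //; apply: imset_f.
(* By injectivity, [c] and [w c] have the same multiplicity and the same colour class, so the
   floor/ceiling condition transfers verbatim. *)
have etaE : eta (fun v => w @: L v) (w c) = eta L c.
  by apply: eq_card => v; rewrite !inE mem_imset.
have preimE : g @^-1: [set w c] = f @^-1: [set c].
  by apply/setP=> v; rewrite !inE gE inj_eq.
by have := g_prop _ wc_pal; rewrite etaE preimE.
Qed.

Theorem proposition6 (k l : nat) (hk : 1 <= k) (hkl : k <= l)
    (V : finType) (adj : rel V)
    (adj_sym : symmetric adj) (adj_irr : irreflexive adj) (V_gt0 : 0 < #|V|) :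
  proportionally_choosable adj k l.+1 -> proportionally_choosable adj k l.
Proof.
apply: (@proportionally_choosable_inj _ _ _ _ _ (widen_ord (leqnSn l))).
by move=> i j /(congr1 val) /= /val_inj.
Qed.
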